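(* Let $G$ be a finite simple graph on $n$ vertices such that no connected component of $G$ is isomorphic to $K_1$ or $K_2$. Then $G$ is weighted--$\left\lfloor \frac{4n}{3}\right\rfloor$--list--antimagic.
   Context: All graphs are finite and simple; $K_1$ and $K_2$ are the complete graphs on one and two vertices. For an integer $k\ge 0$, a graph $G$ is called weighted--$k$--list--antimagic if for every vertex weighting $\omega\colon V(G)\to\mathbb{R}$ and every list assignment $L\colon E(G)\to 2^{\mathbb{R}}$ with $|L(e)|\geq |E(G)|+k$ for all $e\in E(G)$, there exists an edge labeling $f\colon E(G)\to\mathbb{R}$ such that (1) $f(e)\in L(e)$ for all $e\in E(G)$; (2) the labels of distinct edges are distinct (i.e. $f$ is injective); and (3) for all distinct vertices $u,v\in V(G)$, $\omega(u)+\sum_{ux\in E(G)} f(ux)\neq \omega(v)+\sum_{vx\in E(G)} f(vx)$. *)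

(* Defs.v *)
From mathcomp Require Import all_boot all_order all_algebra.

Set Implicit Arguments.
Unset Strict Implicit.
Unset Printing Implicit Defensive.

Record sgraph := SGraph {
  vertex :> finType;
  adj : rel vertex;
  adj_sym : symmetric adj;
  adj_irrefl : irreflexive adj }.

Section Graph.
Variable G : sgraph.

Definition edges : {set {set G}} :=
  [set [set u; v] | u in G, v in G & adj u v].

Definition components : {set {set G}} :=
  [set [set v | connect (@adj G) u v] | u : G].

Definition induced_adj (S : {set G}) : rel {x : G | x \in S} :=
  fun x y => adj (val x) (val y).

Lemma induced_adj_sym S : symmetric (@induced_adj S).
Proof. by move=> x y; exact: adj_sym. Qed.

Lemma induced_adj_irrefl S : irreflexive (@induced_adj S).
Proof. by move=> x; exact: adj_irrefl. Qed.

Definition induced (S : {set G}) : sgraph :=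
  SGraph (@induced_adj_sym S) (@induced_adj_irrefl S).

End Graph.

Definition complete_adj (n : nat) : rel 'I_n := fun i j => i != j.

Lemma complete_adj_sym n : symmetric (@complete_adj n).
Proof. by move=> i j; exact: (congr1 negb (eq_sym i j)). Qed.

Lemma complete_adj_irrefl n : irreflexive (@complete_adj n).
Proof. by move=> i; rewrite /complete_adj eqxx. Qed.

Definition complete_graph (n : nat) : sgraph :=
  SGraph (@complete_adj_sym n) (@complete_adj_irrefl n).

Definition isomorphic (G H : sgraph) : Prop :=
  exists phi : G -> H,
    bijective phi /\ forall x y : G, adj (phi x) (phi y) = adj x y.

From mathcomp Require Import boolp classical_sets cardinality reals.

Local Open Scope ring_scope.

(* Lists and labelings live on all of {set G}; only their values on [edges G]
   are constrained or used. Lists may be infinite, so |L e| >= |E(G)| + k is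
   stated as an injection from a set of |E(G)| + k elements. *)
Definition weighted_list_antimagic (R : realType) (k : nat) (G : sgraph) :
    Prop :=
  forall (w : G -> R) (L : {set G} -> set R),
    (forall e, e \in edges G -> (`I_(#|edges G| + k)%N #<= L e)%card) ->
  exists f : {set G} -> R,
    [/\ forall e, e \in edges G -> L e (f e),
        {in edges G &, injective f} &
        forall u v : G, u != v ->
          w u + \sum_(x | adj u x) f [set u; x]%SET
            != w v + \sum_(x | adj v x) f [set v; x]%SET].

(* Main.v *)
Require Import Defs.
From mathcomp Require Import all_boot all_order all_algebra.
From mathcomp Require Import boolp classical_sets cardinality reals.
From mathcomp Require Import functions zify lra.

Set Implicit Arguments.
Unset Strict Implicit.
Unset Printing Implicit Defensive.
Import Order.TTheory GRing.Theory Num.Theory.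
Local Open Scope ring_scope.

(** Every vertex has a neighbour, so a minimal edge cover is a spanning star
    forest F: a set U of leaves and a centre map p such that every vertex is
    some v or p v with v in U (exists_star_forest). The edges outside F are
    labelled first, arbitrarily except that the two ends of an edge that is a
    whole star of F must get distinct partial sums (exists_prelabelling); this
    is where it matters that no component is a single edge. Their labels are absorbed into the
    vertex weights and removed from the lists of F, which still contain
    |U| + floor(4n/3) elements each. It remains to label a star forest with c
    stars and n - c edges from such lists (solvable_star_forest). There are two
    regimes.

    Many stars, 3c >= n (solvable_many_stars). As long as a star has at least
    two edges left, one of them is labelled greedily: only its leaf becomes
    final. What is left is a matching of c edges, and n - 2c final vertices,
    which forbid at most 2(n - 2c) values per edge; at least 3c - 2 values
    survive. Two edges {v, p v} and {u, p u} of the matching interact through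
    five forbidden differences of labels, one for the labels themselves and four
    for the vertex sums. Measured in the coordinate 2 x + w v + w (p v), the
    four vertex conflicts are two pairs symmetric about the position of the
    chosen label; so if the edge and label that minimize this coordinate are
    chosen first, one conflict of each pair lies out of reach. A choice
    therefore costs each other list at most 3 elements (solvable_matching).

    Few stars, 3c < n (solvable_few_stars). Now there are at least 2n/3 edges,
    hence lists of size 2n. After a translation all labels are positive, and
    they are assigned in increasing order, always taking the least admissible
    label x and, among the edges that admit x, one whose leaf has the least
    weight. An edge {v, p v} loses a list element only to a final vertex t
    (or, at p v, to another leaf t of the same star), through the conflict of t
    with v or with p v. Partial sums only grow, so the value forbidden by such a
    pair only decreases while the threshold increases: each pair costs at most
    one element. Distinctness of the labels costs
    nothing more: when x is also admissible for {v, p v}, the rule for ties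
    makes the conflict of v with the newly final leaf die at the same moment.
    Hence 2(n - 1) values are lost at most (solvable_increasing). *)

(** * Choosing in finite lists *)

Lemma exists_seq_min (disp : Order.disp_t) (T : eqType) (O : orderType disp)
    (F : T -> O) (s : seq T) :
  (0 < size s)%N -> exists2 i, i \in s & forall j, j \in s -> (F i <= F j)%O.
Proof.
elim: s => // a [|b s] IH _.
  by exists a; rewrite ?mem_head // => j; rewrite inE => /eqP ->.
have [//|i iS imin] := IH.
have [ai|ia] := leP (F a) (F i).
  exists a => [|j]; first exact: mem_head.
  by rewrite inE => /predU1P[->//|/imin]; apply: le_trans.
exists i => [|j]; first by rewrite inE iS orbT.
by rewrite inE => /predU1P[->|/imin//]; exact: ltW.
Qed.

Lemma size_filter_notin (T : eqType) (s r : seq T) :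
  uniq s -> (size s <= size [seq y <- s | y \notin r] + size r)%N.
Proof.
move=> us; rewrite -(count_predC (mem r)) addnC !size_filter leq_add2l.
rewrite -size_filter uniq_leq_size ?filter_uniq // => y.
by rewrite mem_filter => /andP[].
Qed.

Lemma exists_notin (T : eqType) (s r : seq T) :
  uniq s -> (size r < size s)%N -> exists2 y, y \in s & y \notin r.
Proof.
move=> us lt; have := size_filter_notin r us.
case E: [seq y <- s | y \notin r] => [|y q] /=; first by lia.
have : y \in [seq y <- s | y \notin r] by rewrite E mem_head.
by rewrite mem_filter => /andP[? ?] _; exists y.
Qed.

(** * Labelling the edges of a star forest *)

Section StarForest.
Variables (R : realFieldType) (V : finType) (p : V -> V).
Implicit Types (U : {set V}) (w x : V -> R) (L : V -> seq R) (u v t : V).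

Definition incident v t := (t == v) || (t == p v).

(** U is the set of leaves whose edge is still unlabelled, and w holds the
    current partial sums; a settled vertex has its final sum. *)
Definition settled U t := [forall v in U, ~~ incident v t].

Definition add_label w v (y : R) t := w t + (if incident v t then y else 0).

Definition star_forest U := {in U, forall v, p v \notin U}.

(** Labels of earlier edges do not appear: they have been added to w and
    removed from the lists L. *)
Definition solvable U w L :=
  exists x, [/\ {in U, forall v, x v \in L v}, {in U &, injective x} &
    injective (fun t => w t + \sum_(v in U | incident v t) x v)].

(** The second condition is needed because the last edge of a star adds the same
    label to the sums of its leaf and of its centre. *)
Definition consistent U w :=
  {in settled U &, injective w} /\
  {in U, forall v, {in U, forall u, p u = p v -> u = v} -> w v != w (p v)}.

Lemma settledP U t :
  reflect {in U, forall v, ~~ incident v t} (settled U t).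
Proof. exact: forall_inP. Qed.

Lemma settled_leaf U v : v \in U -> ~~ settled U v.
Proof.
by move=> vU; apply/settledP => /(_ _ vU); rewrite /incident eqxx.
Qed.

Lemma settled_center U v : v \in U -> ~~ settled U (p v).
Proof.
by move=> vU; apply/settledP => /(_ _ vU); rewrite /incident eqxx orbT.
Qed.

Lemma settledS U U' t : U' \subset U -> settled U t -> settled U' t.
Proof.
by move=> /fintype.subsetP sub /settledP tU; apply/settledP => v /sub; apply: tU.
Qed.

Lemma star_forestS U U' : U' \subset U -> star_forest U -> star_forest U'.
Proof.
by move=> /fintype.subsetP sub sU v /sub /sU; apply: contra; apply: sub.
Qed.

Lemma settledD1 U v t :
  star_forest U -> v \in U -> settled (U :\ v) t ->
  [\/ settled U t, t = v |
      t = p v /\ {in U, forall u, p u = p v -> u = v}].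
Proof.
move=> sU vU /settledP tU.
have [inc|ninc] := boolP (incident v t); last first.
  constructor 1; apply/settledP => u uU.
  by have [->//|uv] := eqVneq u v; apply: tU; rewrite !inE uv.
have [tv|tv] := eqVneq t v; first by constructor 2.
constructor 3; have tpv: t = p v.
  by move: inc; rewrite /incident (negPf tv) => /eqP.
split=> // u uU pu; apply/eqP/negPn/negP => uv.
by have := tU u; rewrite !inE uv uU /incident tpv pu eqxx orbT => /(_ isT).
Qed.

Lemma settledD1_leaf U v : star_forest U -> v \in U -> settled (U :\ v) v.
Proof.
move=> sU vU; apply/settledP => u; rewrite !inE => /andP[uv uU].
rewrite /incident negb_or eq_sym uv /=.
by apply: contraL vU => /eqP ->; apply: sU.
Qed.

Lemma add_label_settled U w v y t :
  v \in U -> settled U t -> add_label w v y t = w t.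
Proof.
by move=> vU /settledP/(_ _ vU)/negPf; rewrite /add_label => ->; rewrite addr0.
Qed.

Lemma add_label_leaf w v y : add_label w v y v = w v + y.
Proof. by rewrite /add_label /incident eqxx. Qed.

Lemma add_label_center w v y : add_label w v y (p v) = w (p v) + y.
Proof. by rewrite /add_label /incident eqxx orbT. Qed.

Lemma add_label_other U w v y u : star_forest U -> v \in U -> u \in U ->
  u != v -> add_label w v y u = w u.
Proof.
move=> sU vU uU uv; rewrite /add_label /incident (negPf uv) /=.
by case: eqP => [E|_]; [have := sU _ vU; rewrite -E uU | rewrite addr0].
Qed.

(** The three kinds of value that the label of v has to avoid: those making the
    leaf clash with a settled vertex, those making the centre clash with another
    leaf of its star (which may become the last one), and, if v is the last leaf
    of its star, those making the centre clash with a settled vertex. *)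
Definition compatible U w v (y : R) :=
  [/\ forall t, settled U t -> y != w t - w v,
      {in U, forall u, u != v -> p u = p v -> y != w u - w (p v)} &
      {in U, forall u, p u = p v -> u = v} ->
        forall t, settled U t -> y != w t - w (p v)].

Lemma consistent_add_label U w v y :
  star_forest U -> v \in U -> consistent U w -> compatible U w v y ->
  consistent (U :\ v) (add_label w v y).
Proof.
move=> sU vU [injw neqw] [cL cS cC].
have wset t : settled U t -> add_label w v y t = w t.
  exact: add_label_settled.
have leafN t : settled U t -> w v + y <> w t.
  by move=> tU E; have := cL _ tU; rewrite -E addrAC subrr add0r eqxx.
split=> [s t|u].
  rewrite !unfold_in => /(settledD1 sU vU)[sU'|->|[-> only]].
  - move/(settledD1 sU vU)=> [tU'|->|[-> only]]; rewrite wset //.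
    + by rewrite wset //; exact: injw.
    + by rewrite add_label_leaf => /esym/leafN; case.
    + rewrite add_label_center => E; have := cC only _ sU'.
      by rewrite E addrAC subrr add0r eqxx.
  - move/(settledD1 sU vU)=> [tU'|->|[-> only]] //; rewrite add_label_leaf.
    + by rewrite wset // => /leafN; case.
    + rewrite add_label_center => /addIr E.
      by have := neqw _ vU only; rewrite E eqxx.
  - move/(settledD1 sU vU)=> [tU'|->|[-> _]] //; rewrite add_label_center.
    + rewrite wset // => E; have := cC only _ tU'.
      by rewrite -E addrAC subrr add0r eqxx.
    + rewrite add_label_leaf => /addIr E.
      by have := neqw _ vU only; rewrite E eqxx.
rewrite !inE => /andP[uv uU] only.
rewrite (add_label_other _ _ sU) //.
have [puv|npuv] := eqVneq (p u) (p v).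
  rewrite puv add_label_center; have := cS _ uU uv puv.
  by apply: contra => /eqP ->; rewrite addrAC subrr add0r.
rewrite /add_label /incident (negPf npuv) orbF.
have -> : (p u == v) = false by apply: contraNF (sU _ uU) => /eqP ->.
rewrite addr0; apply: neqw => // z zU pz.
have [zv|zv] := eqVneq z v; first by case/eqP: npuv; rewrite -pz zv.
by apply: only; rewrite // !inE zv.
Qed.

Lemma solvable_add_label U w L L' v y :
  v \in U -> y \in L v ->
  {in U :\ v, forall u, {subset L' u <= [seq z <- L u | z != y]}} ->
  solvable (U :\ v) (add_label w v y) L' -> solvable U w L.
Proof.
move=> vU yL subL [x [xL xinj sinj]].
have xE u : u \in U :\ v -> u != v /\ (x u != y) && (x u \in L u).
  move=> uU; have := subL _ uU _ (xL _ uU); move: uU.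
  by rewrite !inE mem_filter => /andP[].
exists (fun u => if u == v then y else x u); split.
- move=> u uU; case: eqP => [->//|/eqP uv].
  by have [|_ /andP[]] := xE u; rewrite // !inE uv.
- move=> u t uU tU.
  case: eqP => [->|/eqP uv]; case: eqP => [->|/eqP tv] //.
  + by move=> E; have [|_ /andP[]] := xE t; rewrite ?inE ?tv // E eqxx.
  + by move=> E; have [|_ /andP[]] := xE u; rewrite ?inE ?uv // E eqxx.
  + by apply: xinj; rewrite !inE ?uv ?tv.
- apply: eq_inj sinj _ => t /=; rewrite /add_label -addrA; congr (_ + _).
  have [vt|vt] := boolP (incident v t); last first.
    rewrite add0r; apply: eq_big => [u|u]; rewrite !inE.
      by have [->|] := eqVneq u v; rewrite ?(negPf vt) ?andbF.
    by case/andP=> /andP[/negPf ->].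
  rewrite [RHS](bigD1 v) /= ?vU // eqxx; congr (_ + _); apply: eq_big => u.
    by rewrite !inE -andbA andbC.
  by rewrite !inE => /andP[/andP[/negPf ->]].
Qed.

Lemma solvable0 w L : consistent finset.set0 w -> solvable finset.set0 w L.
Proof.
move=> [injw _]; exists (fun=> 0); split=> [v|v|s t]; rewrite ?inE //.
rewrite !big1 ?addr0; try by move=> v; rewrite inE.
by apply: injw; apply/settledP => v; rewrite inE.
Qed.

(** ** Matchings *)

(** The edge and label minimizing Y are chosen first. For the list of u, the
    values forbidden by the conflicts v-u and p v-p u have coordinates Y
    symmetric about the minimum, and so have those of v-p u and p v-u; since all
    elements of the list have coordinate at least the minimum, only the larger
    value of each pair matters. With the label itself this makes 3 values. *)
Lemma solvable_matching U w L :
  star_forest U -> {in U &, injective p} -> consistent U w ->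
  {in U, forall v, [/\ uniq (L v), (3 * #|U| <= size (L v) + 2)%N &
    forall t y, settled U t -> y \in L v ->
      (y != w t - w v) && (y != w t - w (p v))]} ->
  solvable U w L.
Proof.
elim: {U}_.+1 {-2}U (ltnSn #|U|) w L => // n IH U.
rewrite ltnS => leUn w L sU pinj cons HL.
have [U0|[v1 v1U]] := set_0Vmem U; first by rewrite U0 in cons *; exact: solvable0.
have U_gt0 : (0 < #|U|)%N by rewrite card_gt0; apply/set0Pn; exists v1.
pose cand := [seq (v, y) | v <- enum U, y <- L v].
pose Y (c : V * R) := 2 * c.2 + w c.1 + w (p c.1).
have candP v y : v \in U -> y \in L v -> (v, y) \in cand.
  by move=> vU yL; apply/allpairsPdep; exists v, y; rewrite mem_enum.
have [|[v y] /allpairsPdep[v' [y' [vU yL [? ?]]]] ymin] :=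
    exists_seq_min Y (s := cand).
  have [_ szL _] := HL _ v1U.
  case E: (L v1) szL => [|z q] /=; first by lia.
  move=> _; have : (v1, z) \in cand by apply: candP; rewrite // E mem_head.
  by case: (cand).
subst v' y'; rewrite mem_enum in vU.
have [_ _ clash] := HL _ vU.
have compat : compatible U w v y.
  split=> [t tU|u uU uv puv|_ t tU].
  - by case/andP: (clash _ _ tU yL).
  - by case/eqP: uv; apply: pinj.
  - by case/andP: (clash _ _ tU yL).
pose D u := [:: y; Num.max (y + w v - w u) (y + w (p v) - w (p u));
                   Num.max (y + w v - w (p u)) (y + w (p v) - w u)].
apply: (@solvable_add_label U w L (fun u => [seq z <- L u | z \notin D u]) v y) => //.
  move=> u _ z; rewrite !mem_filter inE negb_or => /andP[/andP[-> _] ->] //.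
apply: IH.
- by move: leUn; rewrite (cardsD1 v U) vU.
- exact: star_forestS (subsetDl _ _) sU.
- by move=> u t /setD1P[_ uU] /setD1P[_ tU]; apply: pinj.
- exact: consistent_add_label.
move=> u /setD1P[uv uU]; have [uL szL clu] := HL _ uU.
split; first exact: filter_uniq.
  have := size_filter_notin (D u) uL; rewrite (cardsD1 v U) vU /= in szL *.
  by rewrite /D /=; lia.
have wpu : add_label w v y (p u) = w (p u).
  rewrite /add_label /incident (_ : p u == p v = false) ?orbF.
    by case: eqP => [E|]; rewrite ?addr0 //; have := sU _ uU; rewrite E vU.
  by apply: contraNF uv => /eqP /(pinj _ _ uU vU) ->.
move=> t z; rewrite mem_filter (add_label_other _ _ sU vU uU uv) wpu.
move=> /(settledD1 sU vU) tE /andP[zD zL].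
have := ymin _ (candP _ _ uU zL); rewrite /Y /= => zge.
move: zD; rewrite !inE !negb_or => /and3P[_ zD1 zD2].
case: tE => [tU|->|[-> _]].
- by rewrite (add_label_settled _ _ vU tU); apply: clu.
- rewrite add_label_leaf; apply/andP; split.
  + apply: contraNN zD1 => /eqP E; rewrite maxEle; case: leP => h; lra.
  + apply: contraNN zD2 => /eqP E; rewrite maxEle; case: leP => h; lra.
- rewrite add_label_center; apply/andP; split.
  + apply: contraNN zD2 => /eqP E; rewrite maxEle; case: leP => h; lra.
  + apply: contraNN zD1 => /eqP E; rewrite maxEle; case: leP => h; lra.
Qed.

(** ** Many stars *)

Lemma card_settled U : star_forest U -> (#|settled U| + #|U| + #|p @: U| <= #|V|)%N.
Proof.
move=> sU; rewrite -(cardsE (settled U)).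
have d1 : [disjoint U & p @: U].
  apply/pred0P => t /=; apply/negP => /andP[tU /imsetP[v vU E]].
  by have := sU _ vU; rewrite -E tU.
have d2 : [disjoint [set t | settled U t]%SET & U :|: p @: U].
  apply/pred0P => t /=; apply/negP; rewrite !inE => /andP[tS /orP[tU|]].
    by have := settled_leaf tU; rewrite tS.
  by case/imsetP => v vU E; have := settled_center vU; rewrite -E tS.
move: d1 d2; rewrite -!leq_card_setU => /eqP d1 /eqP d2.
by rewrite -addnA -d1 -d2 max_card.
Qed.

Lemma solvable_sublists U w L L' :
  {in U, forall v, {subset L' v <= L v}} -> solvable U w L' -> solvable U w L.
Proof.
move=> sub [x [xL xinj sinj]]; exists x; split=> // v vU.
by apply: sub => //; apply: xL.
Qed.

(** While some star has two unlabelled edges, labelling one of them settles its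
    leaf only, so at most one value per vertex is forbidden; the number of stars
    does not change. Once p is injective on U, a matching is left, and removing
    the conflicts with the settled vertices leaves enough for it. *)
Lemma solvable_many_stars U w L :
  star_forest U -> consistent U w -> (#|V| <= 3 * #|p @: U|)%N ->
  {in U, forall v, uniq (L v) /\ (#|U| + (4 * #|V|) %/ 3 <= size (L v))%N} ->
  solvable U w L.
Proof.
elim: {U}_.+1 {-2}U (ltnSn #|U|) w L => // n IH U.
rewrite ltnS => leUn w L sU cons many HL.
have [/dinjectiveP pinj|/dinjectivePn[v vU [u]]] := boolP (dinjectiveb p (mem U)).
  pose D v := [seq w t - w v | t in settled U] ++
              [seq w t - w (p v) | t in settled U].
  apply: (@solvable_sublists U w L (fun v => [seq y <- L v | y \notin D v])).
    by move=> v _ y; rewrite mem_filter => /andP[].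
  apply: solvable_matching => // v vU; have [uL szL] := HL _ vU.
  split; first exact: filter_uniq.
    have := size_filter_notin (D v) uL; have := card_settled sU.
    rewrite card_in_imset // in many *.
    rewrite size_cat !size_map -!cardE; move: many szL.
    by move: (size _) (size _) #|U| #|V| #|settled U|; clear; lia.
  move=> t y tU; rewrite mem_filter mem_cat negb_or => /andP[/andP[y1 y2] _].
  apply/andP; split.
    by apply: contraNN y1 => /eqP ->; apply/fintype.imageP; exists t.
  by apply: contraNN y2 => /eqP ->; apply/fintype.imageP; exists t.
rewrite !inE => /andP[uv uU] puv.
have [uL szL] := HL _ vU.
pose D := [seq w t - (if settled U t then w v else w (p v)) | t in V].
have [|y yL yD] := @exists_notin _ (L v) D uL.
  rewrite size_map -cardE; move: szL; rewrite (cardsD1 v U) vU.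
  by move: (size _) #|V| => l m; clear; lia.
have yDt t : y != w t - (if settled U t then w v else w (p v)).
  by apply: contraNneq yD => ->; apply/fintype.imageP; exists t.
have compat : compatible U w v y.
  split=> [t tU|z zU zv pzv|only].
  - by have := yDt t; rewrite tU.
  - by have := yDt z; rewrite (negPf (settled_leaf zU)).
  - by case/eqP: uv; apply: only.
apply: (@solvable_add_label U w L (fun z => [seq y' <- L z | y' != y]) v y) => //.
  by move=> z _.
apply: IH.
- by move: leUn; rewrite (cardsD1 v U) vU.
- exact: star_forestS (subsetDl _ _) sU.
- exact: consistent_add_label.
- apply: leq_trans many _; rewrite leq_mul2l /= subset_leq_card //.
  apply/fintype.subsetP => _ /imsetP[z zU ->].
  have [->|zv] := eqVneq z v; last by apply: imset_f; rewrite !inE zv.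
  by rewrite puv imset_f // !inE uv.
move=> z /setD1P[zv zU]; have [uz sz] := HL _ zU.
split; first exact: filter_uniq.
have := size_filter_notin [:: y] uz; rewrite (cardsD1 v U) vU in sz *.
rewrite (eq_filter (a2 := fun y' => y' != y)) /=; last by move=> ?; rewrite inE.
by move: sz; move: (size (L z)) (size _) #|_| (_ %/ _)%N; clear; lia.
Qed.

(** ** Few stars *)

(** All labels up to the threshold th are used up. The vertex t is alive for
    the leaf v if it may still, now or once it is settled, forbid a label of v
    above th through the conflict of t with v. *)
Definition alive_leaf U w th v :=
  [set t | (t != v) && (settled U t ==> (th < w t - w v))]%SET.

(** The vertices that the centre p v has to avoid: unlabelled leaves of its own
    star are among them, since the last one must not tie with the centre. Such a
    leaf and the centre gain the same label, so labelling it changes nothing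
    for this conflict. *)
Definition near U v t := settled U t || (t \in U) && (p t == p v).

Definition alive_center U w th v :=
  [set t | (t != v) && (near U v t ==> (th < w t - w (p v)))]%SET.

(** The value that t forbids at p v never increases, which is what allows each
    pair to be charged once. *)
Lemma near_add_label U w u y v t :
  star_forest U -> u \in U -> v \in U -> v != u -> 0 <= y ->
  near U v t ->
  near (U :\ u) v t /\
  add_label w u y t - add_label w u y (p v) <= w t - w (p v).
Proof.
move=> sU uU vU vu y0.
have wpv : w (p v) <= add_label w u y (p v).
  by rewrite lerDl; case: ifP.
case/orP=> [tU|/andP[tU /eqP ptv]].
  rewrite /near (settledS (subsetDl _ _) tU) (add_label_settled _ _ uU tU).
  by split=> //; rewrite lerD2l lerN2.
have [tu|tu] := eqVneq t u.
  rewrite /near tu (settledD1_leaf sU uU) add_label_leaf -ptv tu.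
  by rewrite add_label_center; split=> //; lra.
rewrite /near !inE tu tU ptv eqxx orbT (add_label_other _ _ sU uU tU tu).
by split=> //; rewrite lerD2l lerN2.
Qed.

(** The list of v has more elements than there are alive conflicts, and the
    proof shows that every element discarded by a choice (v, y) kills its own
    conflict: an element z <= y that is forbidden kills the conflict that
    forbids it, and z = y, if allowed, kills the conflict with the new settled
    leaf v. *)
Lemma solvable_increasing U w L th :
  star_forest U -> consistent U w -> 0 <= th ->
  {in U, forall v, [/\ uniq (L v), {in L v, forall y, th < y} &
    (#|alive_leaf U w th v| + #|alive_center U w th v| < size (L v))%N]} ->
  solvable U w L.
Proof.
elim: {U}_.+1 {-2}U (ltnSn #|U|) w L th => // n IH U.
rewrite ltnS => leUn w L th sU cons th0 HL.
have [U0|[v1 v1U]] := set_0Vmem U; first by rewrite U0 in cons *; exact: solvable0.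
pose AL := alive_leaf U w th; pose AC := alive_center U w th.
pose bad v := [seq w t - w v | t in AL v :&: [set t | settled U t]%SET] ++
              [seq w t - w (p v) | t in AC v :&: [set t | near U v t]%SET].
have badN v y : v \in U -> th < y -> y \notin bad v ->
    (forall t, settled U t -> y != w t - w v) /\
    (forall t, t != v -> near U v t -> y != w t - w (p v)).
  move=> vU thy; rewrite mem_cat negb_or => /andP[y1 y2].
  split=> [t tU|t tv tU].
    apply: contraNN y1 => /eqP yE; apply/fintype.imageP; exists t => //.
    rewrite !inE tU -yE thy !andbT.
    by apply: contraTneq tU => ->; exact: settled_leaf.
  apply: contraNN y2 => /eqP yE; apply/fintype.imageP; exists t => //.
  by rewrite !inE tU -yE thy tv.
have sz_bad v : (size (bad v) <= #|AL v| + #|AC v|)%N.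
  by rewrite size_cat !size_map -!cardE leq_add // subset_leq_card // subsetIl.
pose cand := [seq (v, y) | v <- enum U, y <- [seq y <- L v | y \notin bad v]].
have candP v y : v \in U -> y \in L v -> y \notin bad v -> (v, y) \in cand.
  move=> vU yL yB; apply/allpairsPdep.
  by exists v, y; rewrite mem_enum mem_filter yB yL.
(* First the least admissible label y, then the edge of lightest leaf. *)
have [[v2 y] vy2 ymin] : exists2 c, c \in cand & forall c', c' \in cand -> c.2 <= c'.2.
  apply: (@exists_seq_min _ _ _ snd); have [uL _ szL] := HL _ v1U.
  have [z zL zB] := exists_notin uL (leq_ltn_trans (sz_bad v1) szL).
  by have := candP _ _ v1U zL zB; case: (cand).
have [[v y'] vy vmin] : exists2 c, c \in [seq c <- cand | c.2 == y] &
    forall c', c' \in [seq c <- cand | c.2 == y] -> w c.1 <= w c'.1.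
  apply: (@exists_seq_min _ _ _ (fun c => w c.1)).
  have : (v2, y) \in [seq c <- cand | c.2 == y] by rewrite mem_filter eqxx.
  by case: [seq c <- cand | _].
rewrite /= in vmin; move: vy; rewrite mem_filter /= => /andP[/eqP -> {y'}].
case/allpairsPdep=> v' [y' [vU yL [? ?]]]; subst v' y'; move: vU yL; rewrite mem_enum mem_filter => vU /andP[yB yL].
have thy : th < y by have [_ th_lt _] := HL _ vU; apply: th_lt.
have y0 : 0 <= y by lra.
have [yleaf ycenter] := badN _ _ vU thy yB.
have compat : compatible U w v y.
  split=> [//|u uU uv puv|_ t tU].
  - by apply: ycenter; rewrite // /near uU puv eqxx orbT.
  - apply: ycenter; rewrite /near ?tU //.
    by apply: contraTneq tU => ->; exact: settled_leaf.
pose w' := add_label w v y.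
apply: (@solvable_add_label U w L (fun u => [seq z <- L u | y < z]) v y) => //.
  by move=> u _ z; rewrite !mem_filter lt_def => /andP[/andP[-> _] ->].
apply: (IH _ _ _ _ y) => //.
- by move: leUn; rewrite (cardsD1 v U) vU.
- exact: star_forestS (subsetDl _ _) sU.
- exact: consistent_add_label.
move=> u /setD1P[uv uU]; have [uL th_lt szL] := HL _ uU.
split; [exact: filter_uniq | by move=> z; rewrite mem_filter => /andP[] | ].
have wu : w' u = w u by exact: (add_label_other _ _ sU vU uU uv).
pose AL' := alive_leaf (U :\ v) w' y u.
pose AC' := alive_center (U :\ v) w' y u.
have leafS t : settled U t -> settled (U :\ v) t /\ w' t - w' u = w t - w u.
  move=> tU; rewrite (settledS (subsetDl _ _) tU) wu.
  by rewrite /w' (add_label_settled _ _ vU tU).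
have centerS t := @near_add_label U w v y u t sU vU uU uv y0.
have subL : AL' \subset AL u.
  apply/fintype.subsetP => t; rewrite !inE => /andP[-> /implyP h].
  apply/implyP => tU; have [tU' <-] := leafS _ tU.
  exact: lt_trans thy (h tU').
have subC : AC' \subset AC u.
  apply/fintype.subsetP => t; rewrite !inE => /andP[-> /implyP h].
  apply/implyP => tU; have [tU' le] := centerS _ tU.
  exact: lt_le_trans (lt_trans thy (h tU')) le.
(* g1 t is the list element whose loss is charged to the pair of t and the
   leaf u; for the new settled leaf v it is the tie y. *)
pose g1 t := if t == v then y else w t - w u.
have killed : {subset [seq z <- L u | z <= y] <=
    [seq g1 t | t in AL u :\: AL'] ++ [seq w t - w (p u) | t in AC u :\: AC']}.
  move=> z; rewrite mem_filter mem_cat => /andP[zy zL].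
  have thz := th_lt _ zL.
  (* By minimality of y, an element z <= y allowed for u is y itself. *)
  have [zB|zB] := boolP (z \in bad u); last first.
    have zE : z = y.
      by apply/eqP; rewrite eq_le zy (ymin _ (candP _ _ uU zL zB)).
    subst z; apply/orP; left; apply/fintype.imageP; exists v; last by rewrite /g1 eqxx.
    have vle : w v <= w u.
      by apply: (vmin (u, y)); rewrite mem_filter /= eqxx candP.
    rewrite !inE eq_sym uv /= (negPf (settled_leaf vU)) /= andbT.
    rewrite (settledD1_leaf sU vU) /= -leNgt wu /w' add_label_leaf; lra.
  move: zB; rewrite mem_cat => /orP[/fintype.imageP[t tB zE]|/fintype.imageP[t tB zE]].
    apply/orP; left; move: tB; rewrite finset.in_setI => /andP[tA].
    rewrite finset.in_set => tU.
    apply/fintype.imageP; exists t.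
      rewrite finset.in_setD tA andbT !inE negb_and negb_imply.
      by have [-> ->] := leafS _ tU; rewrite -zE -leNgt zy orbT.
    rewrite /g1; case: eqP => // tv.
    by have := settled_leaf vU; rewrite -tv tU.
  apply/orP; right; move: tB; rewrite finset.in_setI => /andP[tA].
  rewrite finset.in_set => tU.
  apply/fintype.imageP; exists t => //.
  rewrite finset.in_setD tA andbT !inE negb_and negb_imply.
  have [-> le] := centerS _ tU.
  by rewrite -leNgt (le_trans le) ?orbT // -zE.
have := uniq_leq_size (filter_uniq _ uL) killed.
rewrite size_cat !size_map -!cardE !cardsDS //.
have := subset_leq_card subL; have := subset_leq_card subC.
have := count_predC (fun z => z <= y) (L u); rewrite -!size_filter.
rewrite (eq_filter (a1 := predC _) (a2 := fun z => y < z)); last first.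
  by move=> z /=; rewrite ltNge.
rewrite -/(AL u) -/(AC u) in szL *; move: szL.
rewrite -/w' -/AL' -/AC'.
move: (size _) (size _) (size _) #|AL u| #|AC u| #|AL'| #|AC'|; clear; lia.
Qed.

Lemma solvable_shift U w L (K : R) :
  solvable U (fun t => w t + \sum_(v in U | incident v t) K)
    (fun v => [seq y - K | y <- L v]) ->
  solvable U w L.
Proof.
move=> [x [xL xinj sinj]]; exists (fun v => x v + K); split.
- by move=> v vU; have /mapP[y yL ->] := xL _ vU; rewrite subrK.
- by move=> u v uU vU /addIr; exact: xinj.
- apply: eq_inj sinj _ => t /=; rewrite big_split /= -addrA; congr (_ + _).
  exact: addrC.
Qed.

(** Labels are translated so that all become positive, which makes the partial
    sums grow. The vertex v itself is never alive for v, so there are at most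
    2(n - 1) alive conflicts. *)
Lemma solvable_few_stars U w L :
  star_forest U -> (forall t, ~~ settled U t) ->
  {in U, forall v, {in U, forall u, p u = p v -> u = v} -> w v != w (p v)} ->
  {in U, forall v, uniq (L v) /\ (2 * #|V| <= size (L v))%N} ->
  solvable U w L.
Proof.
move=> sU cover neqw HL.
pose ys := 0 :: [seq y | v <- enum U, y <- L v].
have [//|y0 _ ymin] := exists_seq_min (@id R) (s := ys).
have Klt v y : v \in U -> y \in L v -> y0 - 1 < y.
  move=> vU yL; have : y0 <= y; last by lra.
  apply: ymin; rewrite inE; apply/orP; right.
  by apply/allpairsPdep; exists v, y; rewrite mem_enum.
apply: (@solvable_shift _ _ _ (y0 - 1)); apply: (@solvable_increasing _ _ _ 0) => //.
  split=> [s t sS|v vU only]; first by have := cover s; rewrite (_ : settled U s).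
  rewrite !(big_pred1 v) ?(can_eq (addrK _)) ?neqw // => u /=.
    apply/andP/eqP => [[uU /orP[/eqP E|/eqP E]]|->].
    - by have := sU _ vU; rewrite E uU.
    - exact: only.
    - by rewrite vU /incident eqxx orbT.
  apply/andP/eqP => [[uU /orP[/eqP //|/eqP E]]|->].
    by have := sU _ uU; rewrite -E vU.
  by rewrite vU /incident eqxx.
move=> v vU; have [uL szL] := HL _ vU; split.
- by rewrite map_inj_uniq //; exact: addIr.
- by move=> y /mapP[z zL ->]; rewrite subr_gt0 (Klt v).
have sub (A : {set V}) : v \notin A -> (#|A| < #|V|)%N.
  move=> vA; rewrite -cardsT; apply/proper_card/properP.
  by split; [exact: finset.subsetT | exists v].
have := sub (alive_leaf U (fun t => w t + \sum_(v in U | incident v t) (y0 - 1)) 0 v).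
have := sub (alive_center U (fun t => w t + \sum_(v in U | incident v t) (y0 - 1)) 0 v).
rewrite !inE eqxx /= => /(_ isT) h1 /(_ isT) h2; rewrite size_map.
move: h1 h2 szL; move: (size _) #|V| => l n; lia.
Qed.

Lemma solvable_star_forest U w L :
  star_forest U -> (forall t, ~~ settled U t) ->
  {in U, forall v, {in U, forall u, p u = p v -> u = v} -> w v != w (p v)} ->
  {in U, forall v, uniq (L v) /\ (#|U| + (4 * #|V|) %/ 3 <= size (L v))%N} ->
  solvable U w L.
Proof.
move=> sU cover neqw HL.
have [many|few] := leqP #|V| (3 * #|p @: U|).
  apply: solvable_many_stars => //; split=> // s t sS.
  by have := cover s; rewrite (_ : settled U s).
apply: solvable_few_stars => // v vU; have [uL szL] := HL _ vU; split=> //.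
have : (#|V| <= #|U| + #|p @: U|)%N.
  apply: leq_trans (leq_card_setU U (p @: U)); rewrite -cardsT subset_leq_card //.
  apply/fintype.subsetP => t _; rewrite inE; move: (cover t).
  rewrite negb_forall_in => /exists_inP[u uU]; rewrite negbK => /orP[] /eqP ->.
    by rewrite uU.
  by rewrite imset_f ?orbT.
move: few szL; move: (size _) #|V| #|U| #|_| => l n a b; clear; lia.
Qed.

End StarForest.

(** * Labelling the remaining edges first *)

(** Each new edge e avoids the labels used before, and one value for each v in U
    such that e meets {v, p v} in exactly one vertex; an edge meeting it in zero
    or two vertices does not change the difference of the two sums. *)
Lemma exists_prelabelling (R : realFieldType) (V : finType) (p : V -> V)
    (U : {set V}) (w : V -> R) (l : {set V} -> seq R) (es : seq {set V}) :
  uniq es ->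
  {in es, forall e, uniq (l e) /\ (size es + #|U| <= size (l e))%N} ->
  exists f : {set V} -> R,
    [/\ {in es, forall e, f e \in l e}, {in es &, injective f} &
      {in U, forall v, (exists2 e, e \in es & (v \in e) != (p v \in e)) ->
        w v + \sum_(e <- es | v \in e) f e !=
        w (p v) + \sum_(e <- es | p v \in e) f e}].
Proof.
elim: es => [|e es IH] /=; first by exists (fun=> 0); split=> // v _ [].
move=> /andP[ees ues] hl.
have [|f [fl finj fS]] := IH ues.
  move=> e' e'es; have [|ul szl] := hl e'; first by rewrite inE e'es orbT.
  by split=> //; apply: leq_trans szl; rewrite leq_add2r.
pose S t := w t + \sum_(e <- es | t \in e) f e.
pose D := [seq f e' | e' <- es] ++
  [seq (if v \in e then S (p v) - S v else S v - S (p v)) | v in U].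
have [ul szl] := hl e (mem_head _ _).
have [|y yl yD] := @exists_notin _ (l e) D ul.
  by rewrite size_cat !size_map -cardE.
move: yD; rewrite mem_cat negb_or => /andP[yD1 yD2].
pose f' e' := if e' == e then y else f e'.
have f'es e' : e' \in es -> f' e' = f e'.
  by rewrite /f'; case: eqP => // -> /(negP ees).
have f'e : f' e = y by rewrite /f' eqxx.
have SE t : w t + \sum_(e' <- e :: es | t \in e') f' e' =
    S t + (if t \in e then y else 0).
  rewrite big_cons f'e /S.
  have -> : \sum_(e' <- es | t \in e') f' e' = \sum_(e' <- es | t \in e') f e'.
    rewrite big_seq_cond [RHS]big_seq_cond.
    by apply: eq_bigr => e' /andP[/f'es].
  by case: ifP; rewrite ?addr0 // -addrA (addrC y).
exists f'; split.
- move=> e'; rewrite inE => /predU1P[->|e'es]; first by rewrite f'e.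
  by rewrite f'es ?fl.
- move=> e1 e2; rewrite !inE => /predU1P[->|e1es] /predU1P[->|e2es] //.
  + by rewrite f'e f'es // => E; rewrite E map_f in yD1.
  + by rewrite f'e f'es // => E; rewrite -E map_f in yD1.
  + by rewrite !f'es //; exact: finj.
- move=> v vU [e' e'es ve']; rewrite !SE.
  have [vpe|vpe] := eqVneq (v \in e) (p v \in e).
    rewrite vpe (can_eq (addrK _)); apply: fS => //; exists e' => //.
    by move: e'es ve'; rewrite inE => /predU1P[->|//]; rewrite vpe eqxx.
  apply: contraNneq yD2 => E; apply/fintype.imageP; exists v => //.
  by move: vpe E; case: (v \in e); case: (p v \in e) => // _; lra.
Qed.

(** * Spanning star forests in graphs *)

Section GraphFacts.
Variable G : sgraph.
Implicit Types (u v t : G) (e : {set G}).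

Lemma mem_edges u v : ([set u; v]%SET \in edges G) = adj u v.
Proof.
apply/imset2P/idP => [[a b aG]|uv]; last by exists u v; rewrite ?inE.
rewrite inE => /andP[_ ab] E.
have : a \in [set u; v]%SET by rewrite E !inE eqxx.
have : b \in [set u; v]%SET by rewrite E !inE eqxx orbT.
rewrite !inE => /orP[]/eqP bE /orP[]/eqP aE; move: ab; rewrite aE bE.
- by rewrite adj_irrefl.
- by rewrite adj_sym.
- by [].
- by rewrite adj_irrefl.
Qed.

Lemma edges_has e u : e \in edges G -> u \in e ->
  exists2 v, adj u v & e = [set u; v]%SET.
Proof.
case/imset2P => a b _; rewrite inE => /andP[_ ab] ->.
rewrite !inE => /orP[] /eqP ->; first by exists b.
by exists a; rewrite 1?adj_sym // finset.setUC.
Qed.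

Lemma sum_adj (M : nmodType) (f : {set G} -> M) u :
  \sum_(x | adj u x) f [set u; x]%SET = \sum_(e in edges G | u \in e) f e.
Proof.
transitivity (\sum_(e in [set [set u; x]%SET | x in [set x | adj u x]%SET]) f e).
  rewrite big_imset /=; first by apply: eq_bigl => x; rewrite inE.
  move=> x y; rewrite !inE => ux uy E.
  have : x \in [set u; y]%SET by rewrite -E !inE eqxx orbT.
  by rewrite !inE => /orP[] /eqP // xu; rewrite xu adj_irrefl in ux.
apply: eq_bigl => e; apply/imsetP/andP => [[x]|[eG ue]].
  by rewrite inE => ux ->; rewrite mem_edges !inE eqxx.
by have [x ux ->] := edges_has eG ue; exists x; rewrite ?inE.
Qed.

Lemma component_in_components u :
  [set v | connect (@adj G) u v]%SET \in components G.
Proof. exact: imset_f. Qed.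

Hypothesis no_K1_K2 : forall C : {set G}, C \in components G ->
  ~ isomorphic (induced C) (complete_graph 1) /\
  ~ isomorphic (induced C) (complete_graph 2).

(** Otherwise the component of u is a single vertex. *)
Lemma exists_neighbor u : exists v, adj u v.
Proof.
apply: contrapT => /forallNP isol.
have [+ _] := no_K1_K2 (component_in_components u); apply.
set C := [set v | _]%SET.
have CE x : x \in C -> x = u.
  rewrite inE => /connectP[[|y q] /=]; first by move=> _ ->.
  by case/andP => /isol.
have uC : u \in C by rewrite inE connect0.
exists (fun=> ord0); split.
  exists (fun=> exist _ u uC) => [[x xC]|i]; last by rewrite /= [RHS]ord1.
  by apply: val_inj; rewrite /= (CE x).
move=> [x xC] [y yC]; rewrite /= /induced_adj /= (CE x) // (CE y) //.
by rewrite adj_irrefl.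
Qed.

(** Otherwise the component of u is the edge uv. *)
Lemma exists_leaving_edge u v : adj u v ->
  exists2 e, e \in edges G & (u \in e) != (v \in e).
Proof.
move=> uv; apply: contrapT => none.
have {}none e : e \in edges G -> (u \in e) = (v \in e).
  by move=> eG; apply/eqP/negPn/negP => ?; apply: none; exists e.
have [_] := no_K1_K2 (component_in_components u); apply.
set C := [set v | _]%SET.
have neq : v != u by apply: contraTneq uv => ->; rewrite adj_irrefl.
have clos : closed (@adj G) (mem [set u; v]%SET).
  apply: (intro_closed (sym_connect_sym (@adj_sym G))).
  move=> x y xy; rewrite !inE => /orP[]/eqP xE; subst x.
    have := none [set u; y]%SET; rewrite mem_edges !inE eqxx (negPf neq) /=.
    by move=> /(_ xy)/esym; rewrite eq_sym => ->; rewrite orbT.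
  have := none [set v; y]%SET; rewrite mem_edges !inE eqxx /= eq_sym (negPf neq) /=.
  by move=> /(_ xy); rewrite eq_sym => ->.
have CE x : (x \in C) = (x == u) || (x == v).
  apply/idP/orP; rewrite inE; last by case=> /eqP ->; rewrite ?connect0 ?connect1.
  by move=> /(closed_connect clos); rewrite !inE eqxx /= => /esym/orP.
have uC : u \in C by rewrite CE eqxx.
have vC : v \in C by rewrite CE eqxx orbT.
exists (fun x => if val x == u then ord0 else ord_max); split.
  exists (fun i => if i == ord0 then exist _ u uC else exist _ v vC).
    move=> [x xC]; apply: val_inj => /=; move: xC; rewrite CE.
    by case: eqP => [->|_] //= /eqP ->.
  move=> i; have [->|i0] := eqVneq i ord0; first by rewrite /= eqxx.
  rewrite /= (negPf neq); apply: val_inj => /=.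
  by case: i i0 => [[|[|]]].
move=> [x xC] [y yC]; rewrite /= /induced_adj /=.
move: xC yC; rewrite !CE => /orP[]/eqP -> /orP[]/eqP ->;
  by rewrite ?eqxx ?(negPf neq) ?adj_irrefl ?uv // adj_sym.
Qed.

(** In a minimal edge cover every edge has a private end, covered by no other
    edge. Choosing one private end per edge as its leaf gives stars: two leaves
    are never joined, because the common edge would have two leaves. *)
Lemma exists_star_forest : exists (p : G -> G) (U : {set G}),
  [/\ {in U, forall v, adj v (p v)}, star_forest p U &
      forall t, ~~ settled p U t].
Proof.
pose cover (C : {set {set G}}) :=
  (C \subset edges G) && [forall v, [exists e in C, v \in e]].
have : exists C, cover C.
  exists (edges G); rewrite /cover subxx; apply/forallP => v.
  have [u vu] := exists_neighbor v.
  by apply/exists_inP; exists [set v; u]%SET; rewrite ?mem_edges ?inE ?eqxx.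
case/ex_minset => C /minsetP[/andP[/fintype.subsetP CG /forallP Ccov] Cmin].
pose private e v := (v \in e) && [forall e' in C, (v \in e') ==> (e' == e)].
have privP e : e \in C -> exists v, private e v.
  move=> eC; apply: contrapT => /forallNP none.
  suff E : C :\ e = C by have := eC; rewrite -E !inE eqxx.
  apply: Cmin (subsetDl _ _); apply/andP; split.
    by apply/fintype.subsetP => e' /setD1P[_ /CG].
  apply/forallP => v; have /exists_inP[e1 e1C ve1] := Ccov v.
  have [E|e1e] := eqVneq e1 e; last by apply/exists_inP; exists e1; rewrite ?inE ?e1e.
  subst e1; have /negP := none v; rewrite /private ve1 /= negb_forall_in.
  case/exists_inP => e' e'C; rewrite negb_imply => /andP[ve' e'e].
  by apply/exists_inP; exists e'; rewrite ?inE ?e'e.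
pose leaf e := [pick v | private e v].
pose U := [set v | [exists e in C, leaf e == Some v]]%SET.
pose p v := odflt v [pick u | [set v; u]%SET \in C].
have leafP e v : leaf e = Some v -> private e v.
  by rewrite /leaf; case: pickP => // ? ? [<-].
have pC v : v \in U -> [set v; p v]%SET \in C.
  rewrite inE => /exists_inP[e eC /eqP/leafP/andP[ve _]].
  have [u _ E] := edges_has (CG _ eC) ve.
  by rewrite /p; case: pickP => [//|/(_ u)]; rewrite -E eC.
have leafE v : v \in U -> leaf [set v; p v]%SET = Some v.
  move=> vU; move: (vU); rewrite inE => /exists_inP[e eC /eqP le].
  have /andP[_ /forall_inP/(_ _ (pC _ vU))] := leafP _ _ le.
  by rewrite !inE eqxx /= => /eqP ->.
have adjp v : v \in U -> adj v (p v) by move=> /pC/CG; rewrite mem_edges.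
exists p, U; split=> [//|v vU|t].
  apply/negP => pU; move: (pU); rewrite inE => /exists_inP[e eC /eqP le].
  have /andP[_ /forall_inP/(_ _ (pC _ vU))] := leafP _ _ le.
  rewrite !inE eqxx orbT /= => /eqP E; move: le; rewrite -E leafE // => -[vp].
  by have := adjp _ vU; rewrite -vp adj_irrefl.
have /exists_inP[e eC te] := Ccov t.
have [v le] : exists v, leaf e = Some v.
  rewrite /leaf; case: pickP => [v _|none]; first by exists v.
  by have [v] := privP _ eC; rewrite none.
have vU : v \in U by rewrite inE; apply/exists_inP; exists e; rewrite ?le.
have /andP[_ /forall_inP/(_ _ (pC _ vU))] := leafP _ _ le.
rewrite !inE eqxx /= => /eqP E.
apply/settledP => /(_ _ vU); rewrite /incident.
by move: te; rewrite -E !inE => ->.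
Qed.

End GraphFacts.

(** * The theorem *)

Lemma card_II_le_seq (T : choiceType) (A : set T) n :
  (`I_n #<= A)%card ->
  exists s : seq T, [/\ uniq s, size s = n & forall y, y \in s -> A y].
Proof.
case/card_leP => h.
pose s := [seq val (h (exist _ (val i) (mem_set (ltn_ord i)))) | i : 'I_n].
exists s; split.
- rewrite map_inj_uniq ?enum_uniq // => i j /val_inj.
  move/(@inj _ _ _ h); rewrite !in_setE => /(_ I I) /(congr1 val) /= ij.
  exact: val_inj.
- by rewrite size_map size_enum_ord.
- by move=> y /mapP[i _ ->]; apply: set_mem; exact: valP.
Qed.

Theorem theorem3 (R : realType) (G : sgraph)
    (no_K1_K2 : forall C : {set G}, C \in components G ->
       ~ isomorphic (induced C) (complete_graph 1) /\
       ~ isomorphic (induced C) (complete_graph 2)) :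
  weighted_list_antimagic R ((4 * #|G|) %/ 3) G.
Proof.
move=> w L Lcard.
have [p [U [adjp sU cover]]] := exists_star_forest no_K1_K2.
pose listed (e : {set G}) (s : seq R) := e \in edges G ->
  [/\ uniq s, size s = (#|edges G| + (4 * #|G|) %/ 3)%N &
      forall y, y \in s -> L e y].
have [|l lP] := boolp.choice (P := listed) _.
  rewrite /listed => e; have [eG|] := boolP (e \in edges G); last by exists [::].
  by have [s sP] := card_II_le_seq (Lcard _ eG); exists s.
pose F := [set [set v; p v]%SET | v in U].
pose es := enum (edges G :\: F).
have starE v u : v \in U -> u \in U -> v \in [set u; p u]%SET -> u = v.
  by move=> vU uU; rewrite !inE => /orP[]/eqP // E; have := sU _ uU; rewrite -E vU.
have star_inj : {in U &, injective (fun v => [set v; p v]%SET)}.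
  by move=> u v uU vU E; apply/esym/starE; rewrite // -E !inE eqxx.
have FG : F \subset edges G.
  by apply/fintype.subsetP => _ /imsetP[v vU ->]; rewrite mem_edges adjp.
have sz_es : (size es + #|U| = #|edges G|)%N.
  rewrite -cardE cardsDS // (card_in_imset star_inj) subnK //.
  by rewrite -(card_in_imset star_inj) subset_leq_card.
have mem_es e : (e \in es) = (e \in edges G) && (e \notin F).
  by rewrite mem_enum inE andbC.
(* The budget |E \ F| + |U| of exists_prelabelling is just |E|. *)
have [|f0 [f0l f0inj f0S]] := @exists_prelabelling R G p U w l es (enum_uniq _).
  move=> e; rewrite mem_es => /andP[/lP[ul szl _] _]; split=> //.
  by rewrite sz_es szl leq_addr.
pose w1 t := w t + \sum_(e <- es | t \in e) f0 e.
pose l1 v := [seq y <- l [set v; p v]%SET | y \notin [seq f0 e | e <- es]].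
have [||x [xl xinj sinj]] := solvable_star_forest (w := w1) (L := l1) sU cover.
(* If v is alone in its star, an edge leaving {v, p v} is not in F. *)
- move=> v vU only; apply: f0S => //.
  have [e eG ve] := exists_leaving_edge no_K1_K2 (adjp _ vU).
  exists e => //; rewrite mem_es eG /=; apply: contra ve => /imsetP[u uU eE].
  have -> : (v \in e) = (u == v).
    apply/idP/eqP => [|uv]; first by rewrite eE => /starE; exact.
    by rewrite eE uv !inE eqxx.
  have [uv|uv] := eqVneq u v; first by rewrite eE uv !inE eqxx orbT.
  rewrite eE !inE; have [E|_] := eqVneq (p v) u.
    by have := sU _ vU; rewrite E uU.
  by have [E|//] := eqVneq (p v) (p u); case/eqP: uv; apply: only.
- move=> v vU; have [|ul szl _] := lP [set v; p v]%SET; first by rewrite mem_edges adjp.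
  split; first exact: filter_uniq.
  have := size_filter_notin [seq f0 e | e <- es] ul.
  rewrite szl -sz_es size_map -/(l1 v).
  by move: (size _) (size _) #|U| (_ %/ _)%N; clear; lia.
pose f e := if [pick v in U | e == [set v; p v]%SET] is Some v then x v else f0 e.
have fF v : v \in U -> f [set v; p v]%SET = x v.
  move=> vU; rewrite /f; case: pickP => [u /andP[uU /eqP E]|/(_ v)].
    by congr x; apply: star_inj.
  by rewrite vU eqxx.
have fes e : e \in es -> f e = f0 e.
  rewrite mem_es /f => /andP[_ eF]; case: pickP => // v /andP[vU /eqP E].
  by case/imsetP: eF; exists v.
have edge_split e : e \in edges G ->
    e \in es \/ exists2 v, v \in U & e = [set v; p v]%SET.
  move=> eG; rewrite mem_es eG; have [/imsetP[v vU ->]|] := boolP (e \in F).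
    by right; exists v.
  by left.
have xl1 v : v \in U -> x v \in l [set v; p v]%SET /\ x v \notin [seq f0 e | e <- es].
  by move=> /xl; rewrite mem_filter => /andP[].
have sumE t : w t + \sum_(y | adj t y) f [set t; y]%SET =
    w1 t + \sum_(v in U | incident p v t) x v.
  rewrite sum_adj -addrA; congr (_ + _).
  rewrite (bigID (mem F)) /= addrC; congr (_ + _).
    rewrite /es big_enum_cond /=; apply: eq_big => [e|e /andP[/andP[eG _] eF]].
      by rewrite !inE andbC andbA.
    by apply: fes; rewrite mem_es eG.
  transitivity (\sum_(e in F | t \in e) f e).
    apply: eq_bigl => e; rewrite -andbA andbC -andbA.
    by have [/(fintype.subsetP FG)->|] := boolP (e \in F); rewrite ?andbF ?andbT.
  rewrite big_mkcondr /= big_imset //= [RHS]big_mkcondr /=.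
  by apply: eq_bigr => v vU; rewrite !inE fF.
exists f; split.
- move=> e eG; have [_ _ lL] := lP _ eG; apply: lL.
  have [ees|[v vU E]] := edge_split _ eG; first by rewrite fes // f0l.
  by rewrite E fF //; have [] := xl1 _ vU.
- move=> e1 e2 /edge_split e1E /edge_split e2E.
  have mixed e v : e \in es -> v \in U -> f0 e <> x v.
    by move=> ees /xl1[_ /negP xN] E; apply: xN; rewrite -E map_f.
  case: e1E => [e1es|[v vU ->]]; case: e2E => [e2es|[u uU ->]].
  + by rewrite !fes //; exact: f0inj.
  + by rewrite fes // fF // => /mixed; case.
  + by rewrite fF // fes // => /esym/mixed; case.
  + by rewrite !fF // => /(xinj _ _ vU uU) ->.
- move=> u v; rewrite !sumE; apply: contraNneq => /sinj ->; exact: eqxx.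
Qed.
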